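(* Let $n$ be a positive integer. For every $f\colon[n]\to\mathbb{Z}$ we have \[ C(f)=\frac12\sum_{i=0}^{n}|\Delta f(i)|, \] where we set $f(0)=f(n+1)=0$.
   Context: Notation: $\mathbb{N}=\{1,2,\dots\}$; $[m]=\{1,\dots,m\}$ for $m\in\mathbb{N}$; for $a,b\in[n]$, $[a,b]=\{i\in[n]\colon a\le i\le b\}$, and $\mathbf{1}_{[a,b]}$ is its indicator function on $[n]$. For $f\colon[n]\to\mathbb{Z}$ the cost of $f$ is \[ C(f)=\min\Big\{\sum_{j=1}^{m}|c_j|\colon f=\sum_{j=1}^{m}c_j\mathbf{1}_{[a_j,b_j]},\ m\in\mathbb{N},\ a_j,b_j\in[n],\ c_j\in\mathbb{Z}\text{ for }j\in[m]\Big\}. \] With $f$ extended by $f(0)=f(n+1)=0$, the forward difference is $\Delta f(i)=f(i+1)-f(i)$ for $i\in\{0,1,\dots,n\}$. *)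

(* Defs.v *)
From mathcomp Require Import all_boot all_order all_algebra.
From mathcomp Require Import boolp.

Set Implicit Arguments.
Unset Strict Implicit.
Unset Printing Implicit Defensive.

Import Order.TTheory GRing.Theory Num.Theory.

Local Open Scope ring_scope.

(* The set [n] = {1, ..., n} is represented by 'I_n: the ordinal k stands for
   the integer k + 1. The order, hence each interval [a, b], is unaffected. *)

Definition interval_ind n (a b i : 'I_n) : int :=
  if (a <= i <= b)%N then 1 else 0.

(* The empty interval (b < a) is allowed. *)
Definition is_decomposition n (f : 'I_n -> int) m
    (c : 'I_m -> int) (a b : 'I_m -> 'I_n) : Prop :=
  forall i : 'I_n, f i = \sum_(j < m) c j * interval_ind (a j) (b j) i.

Definition decomposition_cost n (f : 'I_n -> int) (v : nat) : Prop :=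
  exists (m : nat) (c : 'I_m -> int) (a b : 'I_m -> 'I_n),
    [/\ (0 < m)%N, is_decomposition f c a b & v = (\sum_(j < m) `|c j|)%N].

(* Singleton intervals; n > 0 is needed because the number m of intervals is
   required to be positive. *)
Lemma decomposition_cost_ex n (n_gt0 : (0 < n)%N) (f : 'I_n -> int) :
  exists v, `[< decomposition_cost f v >].
Proof.
exists (\sum_(j < n) `|f j|)%N; apply/asboolP.
exists n, f, id, id; split=> // i.
rewrite (bigD1 i) //= /interval_ind leqnn mulr1 big1 ?addr0 // => j ji.
by rewrite -eqn_leq (inj_eq val_inj) (negbTE ji) mulr0.
Qed.

Definition cost n (n_gt0 : (0 < n)%N) (f : 'I_n -> int) : nat :=
  ex_minn (decomposition_cost_ex n_gt0 f).

Lemma costP n (n_gt0 : (0 < n)%N) (f : 'I_n -> int) :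
  decomposition_cost f (cost n_gt0 f) /\
  forall v, decomposition_cost f v -> (cost n_gt0 f <= v)%N.
Proof.
rewrite /cost; case: ex_minnP => v /asboolP fv v_min.
by split=> // w fw; apply/v_min/asboolP.
Qed.

(* Here k is the actual integer index: extend0 f k is the value of f at k for
   1 <= k <= n, i.e. at the ordinal k - 1, and 0 for k = 0 and k > n. *)
Definition extend0 n (f : 'I_n -> int) (k : nat) : int :=
  if k is k'.+1 then oapp f 0 (insub k') else 0.

Definition forward_diff n (f : 'I_n -> int) (i : nat) : int :=
  extend0 f i.+1 - extend0 f i.

(* Main.v *)
(** Differencing turns an interval indicator into a pair of opposite unit
    jumps, of total variation 2, which gives [>=] by the triangle inequality.
    Conversely the jumps of [f] sum to 0, so a nonzero [f] has an up-jump and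
    a down-jump; subtracting the signed indicator of the interval between them
    costs 1 and lowers the total variation by exactly 2. *)
Require Import Defs.
From mathcomp Require Import all_boot all_order all_algebra.
From mathcomp Require Import zify.

Import Order.TTheory GRing.Theory Num.Theory.

Local Open Scope ring_scope.

Definition variation {n : nat} (f : 'I_n -> int) : int :=
  \sum_(0 <= i < n.+1) `|forward_diff f i|.

Lemma extend0_ord n (f : 'I_n -> int) (i : 'I_n) : extend0 f i.+1 = f i.
Proof. by rewrite /extend0 valK. Qed.

Lemma extend0_gt n (f : 'I_n -> int) k : (n < k)%N -> extend0 f k = 0.
Proof. by case: k => // k lt_nk; rewrite /extend0 insubF // ltnNge -ltnS lt_nk. Qed.

Lemma extend0_sum n m (F : 'I_m -> 'I_n -> int) k :
  extend0 (fun i => \sum_(j < m) F j i) k = \sum_(j < m) extend0 (F j) k.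
Proof.
rewrite /extend0; case: k => [|k]; first by rewrite big1.
by case: insub => //=; rewrite big1.
Qed.

Lemma eq_extend0 n (f g : 'I_n -> int) : f =1 g -> extend0 f =1 extend0 g.
Proof. by move=> fg [|k] //=; case: insub => //= i; rewrite fg. Qed.

Lemma extend0D n (f g : 'I_n -> int) k :
  extend0 (fun i => f i + g i) k = extend0 f k + extend0 g k.
Proof. by case: k => [|k] //=; case: insub. Qed.

Lemma extend0Z n (c : int) (f : 'I_n -> int) k :
  extend0 (fun i => c * f i) k = c * extend0 f k.
Proof. by case: k => [|k] /=; [|case: insub => //=]; rewrite mulr0. Qed.

Lemma forward_diffD n (f g : 'I_n -> int) k :
  forward_diff (fun i => f i + g i) k = forward_diff f k + forward_diff g k.
Proof. by rewrite /forward_diff !extend0D opprD addrACA. Qed.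

Lemma forward_diffZ n (c : int) (f : 'I_n -> int) k :
  forward_diff (fun i => c * f i) k = c * forward_diff f k.
Proof. by rewrite /forward_diff !extend0Z mulrBr. Qed.

(** The ordinal [a] stands for the integer [a.+1], so the indicator rises between [a] and [a.+1] and
    falls between [b.+1] and [b.+2]. *)
Lemma forward_diff_ind n (a b : 'I_n) k : (a <= b)%N ->
  forward_diff (interval_ind a b) k = (k == a)%:R - (k == b.+1)%:R.
Proof.
move=> le_ab; have Eext j :
    extend0 (interval_ind a b) j = (a < j <= b.+1)%N%:R.
  case: (ltnP n j) => [lt_nj|].
    by rewrite extend0_gt //; have := ltn_ord b; lia.
  case: j => [|j] // lt_jn.
  by rewrite (extend0_ord _ _ (Ordinal lt_jn)) /interval_ind /=; case: ifP; lia.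
by rewrite /forward_diff !Eext; lia.
Qed.

Lemma sum_eq_nat n k : (k <= n)%N ->
  \sum_(0 <= i < n.+1) (i == k)%:R = 1 :> int.
Proof.
move=> le_kn; rewrite (bigD1_seq k) ?mem_index_iota ?iota_uniq //=.
by rewrite eqxx big1 ?addr0 // => i /negbTE ->.
Qed.

Lemma variation_ind n (a b : 'I_n) : variation (interval_ind a b) <= 2.
Proof.
(* The value 2 is attained only when [a <= b]; an empty interval has variation 0. *)
have [le_ab|lt_ba] := leqP a b.
  have <- : \sum_(0 <= i < n.+1) ((i == a)%:R + (i == b.+1)%:R) = 2%R :> int.
    by rewrite big_split /= !sum_eq_nat //; have := ltn_ord a; lia.
  by apply: ler_sum => i _; rewrite forward_diff_ind //; lia.
have Eext : extend0 (interval_ind a b) =1 fun=> 0.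
  case=> [|k] //=; case: insub => //= i.
  by rewrite /interval_ind; case: ifP => //; lia.
by rewrite /variation big1 // => i _; rewrite /forward_diff !Eext.
Qed.

Lemma variation_le_cost n (f : 'I_n -> int) v :
  decomposition_cost f v -> variation f <= v%:Z *+ 2.
Proof.
case=> m [c [a [b [_ Ef ->]]]].
have Ed k : forward_diff f k =
    \sum_(j < m) c j * forward_diff (interval_ind (a j) (b j)) k.
  rewrite /forward_diff !(eq_extend0 _ _ _ Ef) !extend0_sum -sumrB.
  by apply: eq_bigr => j _; rewrite !extend0Z mulrBr.
rewrite (big_morph Posz PoszD (erefl 0)) -sumrMnl.
(* After the triangle inequality at each index, exchanging the sums leaves [|c j|] times the
   variation of a single indicator. *)
apply: (@le_trans _ _ (\sum_(0 <= i < n.+1) \sum_(j < m)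
    `|c j| * `|forward_diff (interval_ind (a j) (b j)) i|)).
  apply: ler_sum => i _; rewrite Ed; apply: le_trans (ler_norm_sum _ _ _) _.
  by apply: ler_sum => j _; rewrite normrM.
rewrite exchange_big; apply: ler_sum => j _; rewrite -mulr_sumr -mulr_natr.
by rewrite abszE ler_wpM2l ?variation_ind.
Qed.

Lemma decomposition_cost0 n : (0 < n)%N ->
  decomposition_cost (fun _ : 'I_n => 0) 0.
Proof.
(* A decomposition has at least one interval, so one with coefficient 0 is used. *)
move=> n_gt0; pose o := Ordinal n_gt0; exists 1%N, (fun=> 0), (fun=> o), (fun=> o).
by split=> // [i|]; rewrite big_ord1 ?mul0r.
Qed.

Lemma decomposition_cost_add n (f g : 'I_n -> int) v c a b :
    (forall i, g i = f i + c * interval_ind a b i) ->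
  decomposition_cost f v -> decomposition_cost g (`|c| + v)%N.
Proof.
move=> Eg [m [c' [a' [b' [_ Ef ->]]]]].
(* [ext x y] is the family [y] with [x] prepended at index 0. *)
pose ext T (x : T) (y : 'I_m -> T) (j : 'I_m.+1) := oapp y x (unlift ord0 j).
exists m.+1, (ext _ c c'), (ext _ a a'), (ext _ b b'); split=> // [i|].
  rewrite big_ord_recl /ext unlift_none Eg Ef addrC; congr (_ + _).
  by apply: eq_bigr => j _; rewrite liftK.
rewrite big_ord_recl /ext unlift_none; congr (_ + _)%N.
by apply: eq_bigr => j _; rewrite liftK.
Qed.

(** Telescoping from the value 0 at index 0. Taking [k = n.+1] shows that all jumps sum to 0;
    smaller [k] recover [f] from its jumps. *)
Lemma sum_forward_diff n (f : 'I_n -> int) k :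
  \sum_(0 <= i < k) forward_diff f i = extend0 f k.
Proof. by rewrite telescope_sumr // subr0. Qed.

(** Nonnegative terms with sum 0 would all vanish, contradicting [0 < d p]. *)
Lemma exists_neg_summand n (d : nat -> int) p :
    \sum_(0 <= i < n) d i = 0 -> (p < n)%N -> 0 < d p ->
  exists2 q, (q < n)%N & d q < 0.
Proof.
move=> sum0 lt_pn dp_gt0.
have [/existsP[q dq]|/existsPn d_ge0] := boolP [exists q : 'I_n, d q < 0].
  by exists q.
have d_ge0' (i : 'I_n) : 0 <= d i by rewrite leNgt d_ge0.
move: sum0; rewrite big_mkord => /eqP.
rewrite psumr_eq0 // => /allP/(_ (Ordinal lt_pn)).
by rewrite mem_index_enum /= gt_eqF // => /(_ isT).
Qed.

Lemma exists_opposite_jumps n (f : 'I_n -> int) : variation f != 0 ->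
  exists p q, [/\ (p <= n)%N, (q <= n)%N, 0 < forward_diff f p
                & forward_diff f q < 0].
Proof.
have sum0 : \sum_(0 <= i < n.+1) forward_diff f i = 0.
  by rewrite sum_forward_diff extend0_gt.
rewrite /variation big_mkord psumr_eq0 // => /allPn[/= r _ dr_neq0].
have lt_rn := ltn_ord r.
have [dr_lt0|dr_gt0|dr0] := ltgtP (forward_diff f r) 0.
(* A down-jump of [f] is an up-jump of the negated differences, whose sum is also 0. *)
- have sumN0 : \sum_(0 <= i < n.+1) - forward_diff f i = 0.
    by rewrite sumrN sum0 oppr0.
  have [|p lt_pn dp] := exists_neg_summand _ _ r sumN0 lt_rn.
    by rewrite oppr_gt0.
  by exists p, r; split; rewrite // -oppr_lt0.
- by have [q lt_qn dq] := exists_neg_summand _ _ r sum0 lt_rn dr_gt0; exists r, q.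
- by rewrite dr0 normr0 eqxx in dr_neq0.
Qed.

(** The interval runs from the smaller jump index to the predecessor of the larger one, as its fall
    occurs at [b.+1]; the sign [c] is -1 when [q] comes first. *)
Lemma forward_diff_signed_ind n p q : (p <= n)%N -> (q <= n)%N -> p != q ->
  exists (c : int) (a b : 'I_n), `|c|%N = 1%N /\ forall k,
    c * forward_diff (interval_ind a b) k = (k == p)%:R - (k == q)%:R.
Proof.
move=> le_pn le_qn neq_pq; have [lt_pq|le_qp] := ltnP p q.
  have lt_an : (p < n)%N by lia.
  have lt_bn : (q.-1 < n)%N by lia.
  exists 1, (Ordinal lt_an), (Ordinal lt_bn); split=> // k.
  by rewrite forward_diff_ind /=; lia.
have lt_an : (q < n)%N by lia.
have lt_bn : (p.-1 < n)%N by lia.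
exists (-1), (Ordinal lt_an), (Ordinal lt_bn); split=> // k.
by rewrite forward_diff_ind /=; lia.
Qed.

Lemma cost_le_variation n (f : 'I_n -> int) : (0 < n)%N ->
  exists2 v, decomposition_cost f v & v%:Z *+ 2 <= variation f.
Proof.
move=> n_gt0; have [N] := ubnP `|variation f|%N.
elim: N f => // N IHN f lt_fN.
have var_ge0 (g : 'I_n -> int) : 0 <= variation g by apply: sumr_ge0.
have [var0|/exists_opposite_jumps[p [q [le_pn le_qn dp dq]]]] := eqVneq (variation f) 0.
  exists 0%N; last exact: var_ge0.
  have /allP d0 : all (fun i => `|forward_diff f i| == 0) (index_iota 0 n.+1).
    by move/eqP: var0; rewrite /variation psumr_eq0.
  have f0 i : 0 = f i.
    rewrite -extend0_ord -sum_forward_diff big_nat big1 // => k /andP[_ lt_ki].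
    have := d0 k; rewrite mem_index_iota normr_eq0 => /(_ _)/eqP; apply.
    by have := ltn_ord i; lia.
  have [m [c [a [b [m_gt0 E0 Ec]]]]] := decomposition_cost0 n n_gt0.
  by exists m, c, a, b; split=> // i; rewrite -f0.
have neq_pq : p != q by apply: contraTneq dp => ->; rewrite -leNgt ltW.
have [c [a [b [c1 Ed]]]] := forward_diff_signed_ind n p q le_pn le_qn neq_pq.
pose g i := f i + - c * interval_ind a b i.
(* The differences of [g] are those of [f] lowered by 1 at [p] and raised by 1 at [q]. Being
   integers, they are at least 1 and at most -1 there, so each absolute value drops by exactly 1. *)
have var_g : variation f = variation g + 2.
  have <- : \sum_(0 <= i < n.+1) ((i == p)%:R + (i == q)%:R) = 2%R :> int.
    by rewrite big_split /= !sum_eq_nat.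
  rewrite -big_split; apply: eq_bigr => k _ /=.
  rewrite forward_diffD forward_diffZ mulNr Ed.
  have [->|_] := eqVneq k p; first by rewrite (negbTE neq_pq); lia.
  by have [->|_] := eqVneq k q; lia.
have [|v gv le_v] := IHN g; first by have := var_ge0 g; lia.
exists (`|c| + v)%N; last by rewrite var_g c1; lia.
by apply: (decomposition_cost_add n g f v c a b) gv => i; rewrite /g mulNr subrK.
Qed.

Theorem proposition4 (n : nat) (n_gt0 : (0 < n)%N) (f : 'I_n -> int) :
  (cost n_gt0 f)%:R = 2^-1 * \sum_(0 <= i < n.+1) `|forward_diff f i|%:Q :> rat.
Proof.
have [cost_f cost_min] := costP n_gt0 f.
have [v fv le_v] := cost_le_variation n f n_gt0.
(* Minimality closes the chain: twice the cost is at most [2 * v], hence at most the variation,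
   which is at most twice the cost. *)
have var_cost : variation f = (cost n_gt0 f)%:Z *+ 2.
  by have := variation_le_cost n f _ cost_f; have := cost_min v fv; lia.
rewrite -rmorph_sum /= -/(variation f) var_cost rmorphMn /=.
by rewrite -[X in _ * X]mulr_natl mulKf.
Qed.
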